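(* Let $G$ be a locally compact group with identity $e$. Let $T$ be a right $U$-uniformly discrete subset of $G$ for some neighbourhood $U$ of $e$. If $T$ is an approximable $\mathcal{WAP}(G)$-interpolation set, then there is a relatively compact neighbourhood $V$ of $e$, $V\subseteq U$, such that $VT$ is translation-compact.
   Context: $\mathcal{WAP}(G)$ is the algebra of weakly almost periodic functions: bounded continuous $f:G\to\mathbb C$ whose set of left translates $f_s(t)=f(st)$, $s\in G$, is relatively weakly compact in the Banach space of bounded continuous functions on $G$. $T\subseteq G$ is an approximable $\mathcal{WAP}(G)$-interpolation set if every bounded $f:T\to\mathbb C$ extends to a function in $\mathcal{WAP}(G)$ and, for every neighbourhood $N$ of $e$, there are open neighbourhoods $V_1,V_2$ of $e$ with $\overline{V_1}\subseteq V_2\subseteq N$ such that for each $T_1\subseteq T$ there is $h\in\mathcal{WAP}(G)$ with $h(V_1T_1)\subseteq\{1\}$ and $h(G\setminus V_2T_1)\subseteq\{0\}$. $T$ is right $U$-uniformly discrete if $Us\cap Us'=\emptyset$ for all $s\ne s'$ in $T$. A set $S\subseteq G$ is right translation-compact if every non-relatively compact $L\subseteq G$ contains a finite subset $F$ such that $\bigcap_{b\in F}b^{-1}S$ is relatively compact; left translation-compact if the same holds with $\bigcap_{b\in F}Sb^{-1}$; translation-compact if both. *)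

(* Defs.v *)
From HB Require Import structures.
From mathcomp Require Import all_boot all_order all_algebra.
From mathcomp Require Import complex.
From mathcomp Require Import all_classical all_reals all_analysis.

Set Implicit Arguments.
Unset Strict Implicit.
Unset Printing Implicit Defensive.

Import Order.TTheory GRing.Theory Num.Theory.
Import numFieldNormedType.Exports.

Local Open Scope classical_set_scope.
Local Open Scope ring_scope.

HB.mixin Record isTopologicalGroup G & Topological G & Group G := {
  mulg_continuous : continuous (fun x : G * G => (x.1 * x.2)%g) ;
  invg_continuous : continuous (fun x : G => x^-1%g)
}.

#[short(type="topologicalGroupType")]
HB.structure Definition TopologicalGroup :=
  {G of Topological G & Group G & isTopologicalGroup G}.

(* Typing the complex field as a numFieldType (rather than a bare R[i]) is what
   lets numFieldNormedType.Exports supply its norm and topology. *)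
Definition Cplx (R : realType) : numFieldType := R[i].

Section ComplexModulus.
Variable R : realType.
Implicit Types (z : Cplx R) (M : R).

Definition realc M : Cplx R := real_complex R M.

(* The norm of R[i] takes its values in R[i]; suprema need it in R. *)
Definition modulus z : R := complex.Re (`|z| : Cplx R).

Lemma modulusE z : realc (modulus z) = `|z|.
Proof. exact/RRe_real/(@normr_real (Cplx R)). Qed.

Lemma realc_le M M' : (realc M <= realc M') = (M <= M').
Proof. exact: lecR. Qed.

Lemma realc_lt M M' : (realc M < realc M') = (M < M').
Proof. exact: ltcR. Qed.

Lemma modulus_le z M : (modulus z <= M) = (`|z| <= realc M).
Proof. by rewrite -modulusE realc_le. Qed.

Lemma realcD M M' : realc (M + M') = realc M + realc M'.
Proof. exact: (rmorphD (real_complex R)). Qed.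

Lemma realcM M M' : realc (M * M') = realc M * realc M'.
Proof. exact: (rmorphM (real_complex R)). Qed.

Lemma modulusD z z' : modulus (z + z') <= modulus z + modulus z'.
Proof. by rewrite modulus_le realcD !modulusE ler_normD. Qed.

Lemma modulusM z z' : modulus (z * z') = modulus z * modulus z'.
Proof.
by apply: (@complexI R); rewrite -/(realc _) modulusE normrM -!modulusE -realcM.
Qed.

Lemma modulus_ge0 z : 0 <= modulus z.
Proof. by rewrite -realc_le modulusE normr_ge0. Qed.

End ComplexModulus.

Section BoundedContinuous.
Variables (R : realType) (G : topologicalGroupType).
Implicit Types f : G -> Cplx R.

Lemma bounded_fun_modulus f :
  bounded_fun f <-> exists M, forall x, modulus (f x) <= M.
Proof.
have PG : ProperFilter (globally [set: G]).
  exact: (@globally_properfilter _ _ (1%g : G)).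
split=> [/ex_bound[M hM]|[M hM]].
  exists (modulus M) => x; rewrite modulus_le modulusE.
  have fM : `|f x| <= M by exact: hM.
  by rewrite (@ger0_norm _ M)// (le_trans _ fM).
apply/ex_bound; exists (realc M) => x _.
by rewrite /= -modulus_le.
Qed.

Definition cbfun : {pred G -> Cplx R} :=
  mem [set f : G -> Cplx R | continuous f /\ bounded_fun f].

Lemma cbfun_submod_closed : submod_closed cbfun.
Proof.
split=> [|a f g].
  rewrite inE; split; first exact: cst_continuous.
  apply/bounded_fun_modulus; exists (modulus (0 : Cplx R)) => x.
  exact: lexx.
rewrite !inE => -[cf /bounded_fun_modulus[M hM]].
move=> [cg /bounded_fun_modulus[N hN]]; split.
  move=> x; apply: cvgD; last exact: cg.
  by apply: cvgZr; exact: cf.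
apply/bounded_fun_modulus; exists (modulus a * M + N) => x.
apply: (le_trans (modulusD _ _)); apply: lerD => //.
by rewrite modulusM ler_wpM2l ?modulus_ge0.
Qed.

HB.instance Definition _ :=
  GRing.isSubmodClosed.Build _ _ cbfun cbfun_submod_closed.

(* The Banach space of bounded continuous functions G -> C; its norm, defined
   below, is the supremum norm. *)
Record CB := MkCB { cb_fun :> G -> Cplx R ; cb_funP : cb_fun \in cbfun }.
HB.instance Definition _ := [isSub of CB for cb_fun].
HB.instance Definition _ := [Choice of CB by <:].
HB.instance Definition _ := [SubChoice_isSubLmodule of CB by <:].

Lemma cb_continuous (F : CB) : continuous F.
Proof. by have := cb_funP F; rewrite inE => -[]. Qed.

Lemma cb_bounded (F : CB) : bounded_fun F.
Proof. by have := cb_funP F; rewrite inE => -[]. Qed.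

Definition cb_sup (F : CB) : R := sup [set modulus (F x) | x in setT].

Lemma cb_has_sup (F : CB) : has_sup [set modulus (F x) | x in setT].
Proof.
split; first by exists (modulus (F 1%g)), 1%g.
have /bounded_fun_modulus[M hM] := cb_bounded F.
by exists M => _ [x _ <-].
Qed.

Lemma cb_sup_ge (F : CB) x : modulus (F x) <= cb_sup F.
Proof. by apply: (sup_upper_bound (cb_has_sup F)); exists x. Qed.

Lemma cb_sup_le (F : CB) M : (forall x, modulus (F x) <= M) -> cb_sup F <= M.
Proof.
move=> hM; apply: ge_sup; first exact: (cb_has_sup F).1.
by move=> _ [x _ <-].
Qed.

Definition cb_norm (F : CB) : Cplx R := realc (cb_sup F).

Lemma cb_normD F F' : cb_norm (F + F') <= cb_norm F + cb_norm F'.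
Proof.
rewrite -realcD realc_le; apply: cb_sup_le => x.
by apply: (le_trans (modulusD _ _)); apply: lerD; exact: cb_sup_ge.
Qed.

Lemma cb_normZ a F : cb_norm (a *: F) = `|a| * cb_norm F.
Proof.
rewrite -modulusE -realcM; congr (realc _); apply/eqP; rewrite eq_le.
apply/andP; split.
  apply: cb_sup_le => x; rewrite [leLHS]modulusM.
  by rewrite ler_wpM2l ?modulus_ge0 ?cb_sup_ge.
have [->|a0] := eqVneq a 0.
  rewrite (_ : modulus 0 = 0) ?mul0r; last first.
    by apply: (@complexI R); rewrite -/(realc _) modulusE normr0.
  by apply: (le_trans (modulus_ge0 _)); exact: (cb_sup_ge _ 1%g).
have ma0 : 0 < modulus a.
  by rewrite -realc_lt modulusE normr_gt0.
rewrite mulrC -ler_pdivlMr//; apply: cb_sup_le => x.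
rewrite ler_pdivlMr// mulrC -modulusM.
exact: (cb_sup_ge (a *: F)).
Qed.

Lemma cb_norm0_eq0 F : cb_norm F = 0 -> F = 0.
Proof.
move=> /(@complexI R) F0; apply/val_inj/funext => x /=.
apply/eqP; rewrite -normr_le0 -(modulusE (F x)).
by rewrite -[leRHS]/(realc 0) realc_le -F0 cb_sup_ge.
Qed.

HB.instance Definition _ :=
  Lmodule_isNormed.Build (Cplx R) CB cb_normD cb_normZ cb_norm0_eq0.

Lemma left_translate_cbfun (s : G) (F : CB) :
  (fun t : G => F (s * t)%g) \in cbfun.
Proof.
rewrite inE; split=> [t|].
  apply: continuous_comp; last exact: cb_continuous.
  apply: (@continuous_comp _ _ _ (fun t : G => (s, t))
            (fun x : G * G => (x.1 * x.2)%g)).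
    by apply: cvg_pair; [exact: cvg_cst|exact: cvg_id].
  exact: mulg_continuous.
have /bounded_fun_modulus[M hM] := cb_bounded F.
by apply/bounded_fun_modulus; exists M => t; exact: hM.
Qed.

Definition left_translate (s : G) (F : CB) : CB :=
  MkCB (left_translate_cbfun s F).

End BoundedContinuous.
Arguments CB : clear implicits.

Section WeakTopology.
Variables (K : numFieldType) (V : normedModType K).

Definition topological_dual : Type := {phi : {scalar V} | continuous phi}.

(* The topology sigma(V, V'): initial for the evaluation maps phi |-> phi v into
   the space of scalar functions on the dual with pointwise convergence. *)
Definition dual_eval (v : V) : {ptws topological_dual -> K} :=
  fun phi => sval phi v.

Definition weak_space : Type := V.

HB.instance Definition _ :=
  Topological.copy weak_space (initial_topology dual_eval).

Definition relatively_weakly_compact (A : set V) : Prop :=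
  precompact (A : set weak_space).

End WeakTopology.

Section Definitions.
Variables (R : realType) (G : topologicalGroupType).
Implicit Types (N S T U V : set G) (h : G -> Cplx R).
Local Open Scope group_scope.

Definition WAP : set (G -> Cplx R) :=
  [set (F : G -> Cplx R) | F in [set F : CB R G |
    relatively_weakly_compact [set left_translate s F | s in [set: G]]]].

Definition mulset (A B : set G) : set G := [set a * b | a in A & b in B].

Definition approximable_WAP_interpolation T : Prop :=
  (* f ranges over functions on G, but only its restriction to T matters. *)
  (forall f : G -> Cplx R, [bounded f x | x in T] ->
     exists2 h, WAP h & forall t, T t -> h t = f t) /\
  (forall N, nbhs 1 N -> exists V1 V2 : set G,
     [/\ open_nbhs 1 V1, open_nbhs 1 V2, closure V1 `<=` V2, V2 `<=` N &
       forall T1, T1 `<=` T -> exists2 h, WAP h &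
         (forall x, mulset V1 T1 x -> h x = 1%R) /\
         (forall x, ~ mulset V2 T1 x -> h x = 0%R)]).

Definition right_uniformly_discrete U T : Prop :=
  forall s s', T s -> T s' -> s <> s' ->
    mulset U [set s] `&` mulset U [set s'] = set0.

Definition right_translation_compact S : Prop :=
  forall L, ~ precompact L -> exists F, [/\ finite_set F, F `<=` L &
    precompact (\bigcap_(b in F) mulset [set b^-1] S)].

Definition left_translation_compact S : Prop :=
  forall L, ~ precompact L -> exists F, [/\ finite_set F, F `<=` L &
    precompact (\bigcap_(b in F) mulset S [set b^-1])].

Definition translation_compact S : Prop :=
  right_translation_compact S /\ left_translation_compact S.

End Definitions.

(* Main.v *)
(* Weakly almost periodic functions satisfy Grothendieck's double limit
   criterion: a WAP function h cannot satisfy h(x_n y_m) = 1 for n <= m and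
   h(x_n y_m) = 0 for n > m, nor the same with y_m x_n in place of x_n y_m.
   Take V = V1 from approximability with N contained in U and in a compact set.
   If V T were not right translation-compact, witnessed by L, one could
   alternately choose x_n in L and y_m outside larger and larger compact sets so
   that x_n y_m lies in V T for n <= m, while for m < n it never lies in
   V2 V1^-1 x_k y_l with k <= l.  Let T1 be the set of those t in T for which
   some x_k y_l with k <= l lies in V1 t.  The function h attached to T1 then
   has exactly the forbidden values.  The left-handed case is the same with
   products reversed. *)
From HB Require Import structures.
Require Import Defs.
From mathcomp Require Import all_boot all_order all_algebra.
From mathcomp Require Import complex.
From mathcomp Require Import all_classical all_reals all_analysis.

Set Implicit Arguments.
Unset Strict Implicit.
Unset Printing Implicit Defensive.

Import Order.TTheory GRing.Theory Num.Theory.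
Import numFieldNormedType.Exports.
Local Open Scope classical_set_scope.
Local Open Scope group_scope.

(** * Ultrafilters and weak cluster points *)

Lemma ultra_fmap (X Y : Type) (f : X -> Y) (F : set_system X) :
  UltraFilter F -> UltraFilter (f @ F).
Proof.
move=> FU; split=> [|H HP fFH]; first exact: fmap_proper_filter.
rewrite eqEsubset; split=> // A HA; rewrite /fmap /=.
have [//|FnA] := in_ultra_setVsetC (f @^-1` A) FU.
have HnA : H (~` A) by apply: fFH.
by have [y []] := @filter_ex _ H HP _ (filterI HA HnA).
Qed.

Lemma cluster_closed (T : topologicalType) (F : set_system T) (A : set T) :
  closed A -> F A -> cluster F `<=` A.
Proof.
by move=> /closure_id AE FA x; rewrite clusterE => /(_ A FA); rewrite -AE.
Qed.

(** Weak compactness gives the sequence a weak cluster point [g]. A norm-continuous functional is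
    weakly continuous, so its level set at [c] is weakly closed; as it eventually contains the
    sequence, it contains [g]. *)
Lemma relatively_weakly_compact_cluster (K : numFieldType) (V : normedModType K)
    (A : set V) (f : nat -> V) :
  relatively_weakly_compact A -> (forall n, A (f n)) ->
  exists g : V, forall (phi : {scalar V}) (c : K),
    continuous phi -> (\forall n \near \oo, phi (f n) = c) -> phi g = c.
Proof.
move=> [B AB [/(_ (f @ \oo)) + _]] Af.
case; first by apply: (@nearW _ \oo) => n; exact/AB/Af.
move=> g [_ fg]; exists g => phi c phic fc.
pose phi' : topological_dual V := exist _ phi phic.
have ephi : continuous (fun v : weak_space V => phi v).
  move=> v.
  have c1 : continuous (@dual_eval K V : weak_space V -> _).
    exact: initial_continuous.
  have c2 : continuous (fun u : {ptws topological_dual V -> K} => u phi').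
    exact: (@proj_continuous {classic topological_dual V} (fun=> K) phi').
  exact: (continuous_comp (c1 v) (c2 _)).
apply: (@cluster_closed _ _ [set v : weak_space V | phi v = c] _ _ g fg).
  apply: (@closed_comp _ _ (fun v : weak_space V => phi v) [set c]).
    by move=> v _; exact: ephi.
  exact/accessible_closed_set1/hausdorff_accessible/norm_hausdorff.
exact: fc.
Qed.

Section ComplexDisk.
Local Open Scope ring_scope.
Variable R : realType.

Lemma realc_continuous : continuous (@realc R).
Proof.
move=> x; apply/cvgrPdist_lt => e e0.
have eE : realc (complex.Re e) = e.
  by apply/RRe_real/gtr0_real.
have Re0 : 0 < complex.Re e by rewrite -realc_lt eE.
near=> z; rewrite -eE -[realc x - realc z](rmorphB (real_complex R)).
have -> : `|real_complex R (x - z) : Cplx R| = realc `|x - z|.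
  by rewrite [LHS]normc_def /= expr0n /= addr0 sqrtr_sqr.
rewrite realc_lt; near: z; exact: cvgr_dist_lt.
Unshelve. all: by end_near. Qed.

Lemma modulus_Re (z : Cplx R) : `|complex.Re z| <= modulus z.
Proof. by rewrite -realc_le modulusE; exact: normc_ge_Re. Qed.

Lemma modulus_Im (z : Cplx R) : `|complex.Im z| <= modulus z.
Proof.
rewrite -realc_le modulusE; case: z => a b /=.
by rewrite [leRHS]normc_def /= lecR -sqrtr_sqr ler_wsqrtr// lerDr sqr_ge0.
Qed.

Lemma modulus_disk_subset_compact (M : R) :
  exists2 K : set (Cplx R), compact K & [set z | modulus z <= M] `<=` K.
Proof.
pose f (ab : R * R) : Cplx R := realc ab.1 + 'i%C * realc ab.2.
exists (f @` (`[-M, M] `*` `[-M, M])).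
  apply: continuous_compact; last first.
    by apply: compact_setX; exact: segment_compact.
  apply: continuous_subspaceT => ab; apply: cvgD.
    apply: (@continuous_comp _ _ _ fst (@realc R)); first exact: cvg_fst.
    exact: realc_continuous.
  apply: cvgMr.
  apply: (@continuous_comp _ _ _ snd (@realc R)); first exact: cvg_snd.
  exact: realc_continuous.
move=> z /= zM; exists (complex.Re z, complex.Im z).
  by split; rewrite /= in_itv /= -ler_norml;
    [exact: le_trans (modulus_Re z) zM | exact: le_trans (modulus_Im z) zM].
by rewrite [RHS]complexE.
Qed.
End ComplexDisk.

(** * Limits along an ultrafilter as continuous functionals *)

Section UltraLimit.
Local Open Scope ring_scope.
Variables (R : realType) (G : topologicalGroupType).
Variables (y : nat -> G) (H : set_system nat).
Hypothesis HU : UltraFilter H.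
Implicit Types F : CB R G.

Definition ultra_eval F : Cplx R := lim (F (y m) @[m --> H]).

(** The values of a bounded function stay in a compact set, on which the image ultrafilter
    converges. *)
Lemma ultra_eval_cvg F : F (y m) @[m --> H] --> ultra_eval F.
Proof.
have [K + sK] := modulus_disk_subset_compact (cb_sup F).
rewrite compact_ultra => /(_ _ (ultra_fmap (fun m => F (y m)) HU)).
case; first by apply: (@nearW _ H) => m; apply: sK; exact: cb_sup_ge.
move=> z [_ /= Fz].
suff -> : ultra_eval F = z by [].
have Fz' : F (y m) @[m --> H] --> (z : Cplx R) by exact: Fz.
by apply: (cvg_lim (@norm_hausdorff _ (Cplx R)) Fz').
Qed.

Lemma ultra_evalE F z : (\forall m \near H, F (y m) = z) -> ultra_eval F = z.
Proof.
move=> Fz; apply: cvg_lim; first exact: norm_hausdorff.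
exact: cvg_near_cst.
Qed.

Lemma ultra_eval_scalar : scalar ultra_eval.
Proof.
move=> a F F'; apply: cvg_lim; first exact: norm_hausdorff.
apply: cvgD; last exact: ultra_eval_cvg.
by apply: cvgMr; exact: ultra_eval_cvg.
Qed.

HB.instance Definition _ :=
  GRing.isLinear.Build (Cplx R) (CB R G) (Cplx R) *%R ultra_eval
    ultra_eval_scalar.

Lemma ultra_eval_continuous : continuous ultra_eval.
Proof.
apply: bounded_linear_continuous; apply/bounded_funP => r.
(* The summand [1] pays for replacing the limit by a single value [F (y m)] at distance less than 1
   from it. *)
exists (1 + r) => F Fr.
have /cvgrPdist_lt/(_ _ ltr01)/filter_ex[m Fm] := @ultra_eval_cvg F.
rewrite -[leLHS]/(`|ultra_eval F|) -[ultra_eval F](subrK (F (y m))).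
apply: le_trans (ler_normD _ _) _.
apply: lerD; first exact: ltW.
by apply: le_trans Fr; rewrite -modulus_le cb_sup_ge.
Qed.
End UltraLimit.

Section DoubleLimit.
Local Open Scope ring_scope.
Variables (R : realType) (G : topologicalGroupType).

Definition cb_eval (t : G) (F : CB R G) : Cplx R := F t.

Lemma cb_eval_scalar t : scalar (cb_eval t).
Proof. by []. Qed.

HB.instance Definition _ t :=
  GRing.isLinear.Build (Cplx R) (CB R G) (Cplx R) *%R (cb_eval t)
    (cb_eval_scalar t).

Lemma cb_eval_continuous t : continuous (cb_eval t).
Proof.
apply: bounded_linear_continuous; apply/bounded_funP => r.
by exists r => F Fr; rewrite (le_trans _ Fr)// -modulus_le cb_sup_ge.
Qed.

(* A weak cluster point [g] of the translates by [x n] equals [c] at every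
   [y m], so the ultrafilter limit of the evaluations at [y m] sends [g] to [c];
   it sends every translate, hence also [g], to [d]. *)
Lemma WAP_double_limit (h : G -> Cplx R) (x y : nat -> G) (c d : Cplx R) :
  WAP h ->
  (forall m, \forall n \near \oo, h (x n * y m)%g = c) ->
  (forall n, \forall m \near \oo, h (x n * y m)%g = d) ->
  c = d.
Proof.
move=> [F wF <-] hc hd.
have [g gE] := relatively_weakly_compact_cluster
  (f := fun n => left_translate (x n) F) wF (fun n => imageP _ I).
have [H [HU ooH]] := @ultraFilterLemma _ \oo _.
have gy m : g (y m) = c.
  by apply: (gE (cb_eval (y m))); [exact: cb_eval_continuous|exact: hc].
have gd : ultra_eval y H g = d.
  apply: (gE (ultra_eval y H)); first exact: ultra_eval_continuous.
  by apply: nearW => n; apply: ultra_evalE; apply: ooH; exact: hd.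
rewrite -gd; apply/esym/ultra_evalE.
exact: nearW.
Qed.
End DoubleLimit.

(** * Compact products and division by finite sets *)

Section CompactProducts.
Variable G : topologicalGroupType.
Implicit Types A B K : set G.

Definition invset A : set G := [set a^-1 | a in A].

Lemma mulset_compact A B : compact A -> compact B -> compact (mulset A B).
Proof.
move=> cA cB; rewrite /mulset image2E.
rewrite (_ : uncurry _ = fun x : G * G => x.1 * x.2); last first.
  by apply/funext => -[].
apply: continuous_compact; last exact: compact_setX.
by apply: continuous_subspaceT; exact: mulg_continuous.
Qed.

Lemma invset_compact A : compact A -> compact (invset A).
Proof.
move=> cA; apply: continuous_compact => //.
by apply: continuous_subspaceT; exact: invg_continuous.
Qed.

Lemma not_precompact_ex A K : hausdorff_space G ->
  ~ precompact A -> compact K -> exists2 x, A x & ~ K x.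
Proof.
move=> hG nA cK; apply: contrapT => /forall2NP AK; apply: nA.
exists K; last by split=> //; exact: compact_closed.
by move=> x Ax; case: (AK x) => // /contrapT.
Qed.

End CompactProducts.

(* Taking [p x y] to be [x * y] or [y * x] treats right and left
   translation-compactness at once. *)
Definition division_compact (G : topologicalGroupType) (p : G -> G -> G) :=
  forall A K : set G, finite_set A -> compact K ->
  (exists2 K', compact K' & forall x y, A y -> K (p x y) -> K' x) /\
  (exists2 K', compact K' & forall x y, A x -> K (p x y) -> K' y).

(** * Inductive construction of the two sequences *)

Section HalfGraph.
Variables (G : topologicalGroupType) (hG : hausdorff_space G).
Variable p : G -> G -> G.
Hypothesis pdiv : division_compact p.
Variables (W S L : set G).
Hypothesis cW : compact W.
Hypothesis nL : ~ precompact L.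
Hypothesis nS : forall F, finite_set F -> F `<=` L ->
  ~ precompact [set y | forall x, F x -> S (p x y)].

(** First [x] is chosen outside a compact set determined by the old points, then [y] outside one
    that also depends on [x]. The two exclusions are those whose newest point is [x], respectively
    [y]. *)
Lemma half_graph_step (X Y : set G) :
  finite_set X -> finite_set Y -> X `<=` L -> exists x y, [/\ L x,
    (forall x', (x |` X) x' -> S (p x' y)),
    (forall y' a b, Y y' -> X a -> Y b -> ~ mulset W [set p a b] (p x y')) &
    (forall x' y' a, (x |` X) x' -> Y y' -> (x |` X) a ->
       ~ mulset W [set p a y] (p x' y'))].
Proof.
move=> fX fY XL.
pose P := [set p a b | a in X & b in Y].
have cP : compact (mulset W P).
  by apply: mulset_compact => //; apply/finite_compact/finite_image2.
have [[K cK KP] _] := pdiv fY cP.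
have [x Lx Kx] := not_precompact_ex hG nL cK.
have fX' : finite_set (x |` X) by rewrite finite_setU.
(* The equation [p x' y' = w * p a y] is rewritten as [p a y = w^-1 * p x' y'], whose right side
   ranges over a compact set independent of [y]. *)
pose P' := [set p a b | a in x |` X & b in Y].
have cP' : compact (mulset (invset W) P').
  apply: mulset_compact; first exact: invset_compact.
  by apply/finite_compact/finite_image2.
have [_ [K' cK' K'P]] := pdiv fX' cP'.
have X'L : x |` X `<=` L by move=> z [->|/XL].
have [y Sy K'y] := not_precompact_ex hG (nS fX' X'L) cK'.
exists x, y; split=> //.
- move=> y' a b Yy' Xa Yb [w Ww [_ -> wE]]; apply: Kx; apply: (KP _ y') => //.
  rewrite -wE; exists w => //; exists (p a b) => //.
  by exists a => //; exists b.
- move=> x' y' a Xx' Yy' Xa [w Ww [_ -> wE]]; apply: K'y; apply: (K'P a) => //.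
  exists w^-1; first by exists w.
  exists (p x' y'); first by exists x' => //; exists y'.
  by rewrite -wE mulKg.
Qed.

Lemma half_graph : exists x y : nat -> G,
  (forall n m, (n <= m)%N -> S (p (x n) (y m))) /\
  (forall n m k l, (m < n)%N -> (k <= l)%N ->
     ~ mulset W [set p (x k) (y l)] (p (x n) (y m))).
Proof.
(* A state holds the points chosen so far on each side and the latest pair. [rel] assumes [ok] so
   that every state has a successor, as dependent choice requires. *)
pose St := ((set G * set G) * (G * G))%type.
pose ok (s : St) := [/\ finite_set s.1.1, finite_set s.1.2 & s.1.1 `<=` L].
pose rel (s t : St) := ok s -> [/\ ok t,
   t.1.1 = t.2.1 |` s.1.1, t.1.2 = t.2.2 |` s.1.2 &
   [/\ (forall x', t.1.1 x' -> S (p x' t.2.2)),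
    (forall y' a b, s.1.2 y' -> s.1.1 a -> s.1.2 b ->
       ~ mulset W [set p a b] (p t.2.1 y')) &
    (forall x' y' a, t.1.1 x' -> s.1.2 y' -> t.1.1 a ->
       ~ mulset W [set p a t.2.2] (p x' y'))]].
have step s : {t | rel s t}.
  apply: cid; have [oks|] := pselect (ok s); last by exists s.
  case: (oks) => fX fY XL.
  have [x [y [Lx h1 h2 h3]]] := half_graph_step fX fY XL.
  exists ((x |` s.1.1, y |` s.1.2), (x, y)) => _; split=> //.
  by split=> /=; rewrite ?finite_setU//; move=> z [->|/XL].
have [f [f0 fS]] := dependent_choice step ((set0, set0), (1, 1)).
have okf n : ok (f n).
  by elim: n => [|n /fS[]//]; rewrite f0; split=> //=; exact: finite_set0.
have {}fS n := fS n (okf n).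
(* The initial pair [(1, 1)] is a dummy that never enters the sets, hence the shift by one. *)
pose x n := (f n.+1).2.1; pose y n := (f n.+1).2.2.
have inX n m : (n < m)%N -> (f m).1.1 (x n).
  elim: m => // m IH; rewrite ltnS leq_eqVlt => /predU1P[->|nm].
    by have [_ -> _ _] := fS m; left.
  by have [_ -> _ _] := fS m; right; exact: IH.
have inY n m : (n < m)%N -> (f m).1.2 (y n).
  elim: m => // m IH; rewrite ltnS leq_eqVlt => /predU1P[->|nm].
    by have [_ _ -> _] := fS m; left.
  by have [_ _ -> _] := fS m; right; exact: IH.
exists x, y; split=> [n m nm|n m k l mn kl].
  by have [_ _ _ [h _ _]] := fS m; apply: h; exact: inX.
(* If [l < n], the exclusion was secured when [x n] was chosen; otherwise [m < l] while [n] and [k]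
   are at most [l], and it was secured when [y l] was chosen. *)
have [ln|nl] := ltnP l n.
  have [_ _ _ [_ h _]] := fS n; apply: h; [exact: inY| |exact: inY].
  exact/inX/(leq_ltn_trans kl).
have [_ _ _ [_ _ h]] := fS l; apply: h; [exact: inX| |exact: inX].
exact/inY/(leq_trans mn).
Qed.
End HalfGraph.

Lemma mulg_division_compact (G : topologicalGroupType) :
  division_compact (fun x y : G => x * y).
Proof.
move=> A K fA cK; have cA := invset_compact (finite_compact fA).
split.
  exists (mulset K (invset A)); first exact: mulset_compact.
  move=> x y Ay Kxy; exists (x * y) => //; exists y^-1; first by exists y.
  by rewrite mulgK.
exists (mulset (invset A) K); first exact: mulset_compact.
move=> x y Ax Kxy; exists x^-1; first by exists x.
by exists (x * y) => //; rewrite mulKg.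
Qed.

Lemma mulg_op_division_compact (G : topologicalGroupType) :
  division_compact (fun x y : G => y * x).
Proof.
move=> A K fA cK.
have [[K1 cK1 h1] [K2 cK2 h2]] := mulg_division_compact fA cK.
split; [exists K2|exists K1] => // x y.
  exact: h2.
exact: h1.
Qed.

(** * From the double limit criterion to translation-compactness *)

Section TranslationCompact.
Variables (R : realType) (G : topologicalGroupType) (hG : hausdorff_space G).
Variable p : G -> G -> G.
Hypothesis pdiv : division_compact p.
Hypothesis p_double_limit : forall (h : G -> Cplx R) (x y : nat -> G),
  WAP h -> (forall n m, (n <= m)%N -> h (p (x n) (y m)) = 1%R) ->
  (forall n m, (m < n)%N -> h (p (x n) (y m)) = 0%R) -> False.

Lemma mulset_translation_compact (V1 V2 T K L : set G) :
  compact K -> V1 `<=` K -> V2 `<=` K ->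
  (forall T1, T1 `<=` T -> exists2 h : G -> Cplx R, WAP h &
     (forall x, mulset V1 T1 x -> h x = 1%R) /\
     (forall x, ~ mulset V2 T1 x -> h x = 0%R)) ->
  ~ precompact L -> exists F, [/\ finite_set F, F `<=` L &
    precompact [set y | forall x, F x -> mulset V1 T (p x y)]].
Proof.
move=> cK V1K V2K hT nL; apply: contrapT => /forallNP nF.
have cW : compact (mulset K (invset K)).
  by apply: mulset_compact => //; exact: invset_compact.
have [|x [y [xyS xyW]]] :=
    half_graph (S := mulset V1 T) hG pdiv cW nL.
  by move=> F fF FL pF; apply: (nF F).
have [|h Wh [h1 h0]] := hT [set t | T t /\ exists k l,
    (k <= l)%N /\ mulset V1 [set t] (p (x k) (y l))].
  by move=> t [].
apply: (@p_double_limit h x y Wh) => n m nm.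
  apply: h1; have [v Vv [t Tt vt]] := xyS n m nm.
  exists v => //; exists t => //; split=> //; exists n, m; split=> //.
  by exists v => //; exists t.
apply: h0 => -[v2 V2v2 [t [_ [k [l [kl [v1 V1v1 [_ -> v1t]]]]]] v2t]].
(* Eliminating [t] from [v1 * t = p (x k) (y l)] and [v2 * t = p (x n) (y m)] leaves the factor
   [v2 * v1^-1], which lies in the compact set [K K^-1] used as [W]. *)
apply: (xyW n m k l nm kl); exists (v2 * v1^-1).
  by exists v2; [exact: V2K|exists v1^-1 => //; exists v1 => //; exact: V1K].
by exists (p (x k) (y l)) => //; rewrite -v2t -v1t -mulgA mulKg.
Qed.
End TranslationCompact.

Theorem corollary4p12 (R : realType) (G : topologicalGroupType)
    (hG : hausdorff_space G) (lcG : locally_compact [set: G])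
    (U T : set G) (hU : nbhs (1 : G) U)
    (udT : right_uniformly_discrete U T)
    (apT : approximable_WAP_interpolation R T) :
  exists V : set G,
    [/\ nbhs (1 : G) V, precompact V, V `<=` U &
        translation_compact (mulset V T)].
Proof.
have [K + [cK clK]] := lcG 1 I; rewrite withinET => nK.
have [_ /(_ _ (filterI hU nK))[V1 [V2 [[oV1 V11] _ V12 V2N hT]]]] := apT.
have V2K : V2 `<=` K by move=> x /V2N[].
have V1V2 : V1 `<=` V2 by move=> x /subset_closure/V12.
have V1K := subset_trans V1V2 V2K.
have near_ge m (P : nat -> Prop) : (forall n, (m < n)%N -> P n) ->
    \forall n \near \oo, P n by move=> mP; exists m.+1.
exists V1; split; first exact: open_nbhs_nbhs.
- by exists K.
- by move=> x /V1V2/V2N[].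
split=> L nL.
- have [|F [fF FL pF]] := mulset_translation_compact hG
    (@mulg_division_compact G) _ cK V1K V2K hT nL.
    move=> h x y Wh h1 h0; apply: (elimN eqP (oner_neq0 (Cplx R))).
    apply/esym; apply: (@WAP_double_limit _ _ h x y) => // n.
      exact/near_ge/(h0 ^~ n).
    by apply: near_ge => m /ltnW; exact: h1.
  (* A point [y] lies in [b^-1 S] exactly when [b * y] lies in [S]. *)
  exists F; split=> //; apply: precompact_subset pF => y Fy x Fx.
  by have [_ -> [s Ss <-]] := Fy x Fx; rewrite mulVKg.
- have [|F [fF FL pF]] := mulset_translation_compact hG
    (@mulg_op_division_compact G) _ cK V1K V2K hT nL.
    move=> h x y Wh h1 h0; apply: (elimN eqP (oner_neq0 (Cplx R))).
    (* Here [p x y] is [y * x], so the sequences exchange roles, and the two iterated limits are 1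
       and 0 in this order. *)
    apply: (@WAP_double_limit _ _ h y x) => // n.
      by apply: near_ge => m /ltnW; exact: h1.
    exact/near_ge/(h0 ^~ n).
  exists F; split=> //; apply: precompact_subset pF => y Fy x Fx.
  by have [s Ss [_ -> <-]] := Fy x Fx; rewrite mulgVK.
Qed.
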